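(* Let $\tau,k$ be integers such that $\tau-1\geq k\geq 1$. Let $D=(V,A)$ be a digraph, and $w\in\{0,1\}^A$. Suppose $w(\delta^+(U))+\left(\frac{\tau}{k}-1\right)w(\delta^-(U))\geq\tau$ for all $U\subsetneq V$, $U\neq\emptyset$. Then $\{a\in A: w_a=1\}$ can be decomposed (partitioned) into a $k$-arc-connected flip of $D[\{a\in A: w_a=1\}]$ and a $(\tau-k)$-dijoin of $D$.
   Context: Digraphs are finite and may have parallel arcs. For a digraph $D=(V,A)$ and $U\subseteq V$, $\delta^+(U)=\delta^+_D(U)$ and $\delta^-(U)=\delta^-_D(U)$ denote the sets of arcs of $D$ leaving and entering $U$, respectively. For $w\in\mathbb{R}^A$ and $B\subseteq A$, $w(B):=\sum_{a\in B}w_a$. For $J\subseteq A$, $D[J]$ denotes the subdigraph with vertex set $V$ and arc set $J$. For an integer $k\geq 1$, a $k$-arc-connected flip of a digraph $D'=(V,A')$ is a subset $J\subseteq A'$ such that after reversing the arcs of $J$ the digraph $D'$ becomes (strongly) $k$-arc-connected, i.e. $|\delta_{D'}^+(U)\cap J|+|\delta_{D'}^-(U)|-|\delta_{D'}^-(U)\cap J|\geq k$ for all $U\subsetneq V$, $U\neq\emptyset$. A dicut of $D$ is an arc subset of the form $\delta^+(U)$ where $U\subsetneq V$, $U\neq\emptyset$ and $\delta^-(U)=\emptyset$. For an integer $m\geq 1$, an $m$-dijoin of $D$ is a subset of $A$ that intersects every dicut of $D$ in at least $m$ arcs. *)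

(* Defs.v *)
From mathcomp Require Import all_boot all_order all_algebra.

Set Implicit Arguments.
Unset Strict Implicit.
Unset Printing Implicit Defensive.

Import Order.TTheory GRing.Theory Num.Theory.

(* A finite digraph with vertex set V.  Its arcs are the labels in [arcs D],
   drawn from an ambient finite type E, so that parallel arcs are distinct
   labels and a subdigraph of D is a digraph over the same labels: arc sets of
   D and of its subdigraphs can be compared directly.  The values of [src] and
   [tgt] outside [arcs D] are never used.  Loops are not excluded. *)
Record digraph (V E : finType) := Digraph {
  arcs : {set E};
  src : E -> V;
  tgt : E -> V }.

Section Digraphs.
Variables V E : finType.
Implicit Types (D : digraph V E) (U : {set V}) (B J : {set E}).

Definition dout D U : {set E} :=
  [set a in arcs D | (src D a \in U) && (tgt D a \notin U)].

Definition din D U : {set E} :=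
  [set a in arcs D | (src D a \notin U) && (tgt D a \in U)].

(* Meant for [J \subset arcs D]. *)
Definition subdigraph D J : digraph V E := Digraph J (src D) (tgt D).

Definition reverse D J : digraph V E :=
  Digraph (arcs D)
    (fun a => if a \in J then tgt D a else src D a)
    (fun a => if a \in J then src D a else tgt D a).

(* Since U ranges over all nonempty proper vertex sets, asking this of
   entering arcs or of leaving arcs is the same. *)
Definition arc_connected (k : nat) D : Prop :=
  forall U, U != set0 -> U \proper [set: V] -> k <= #|din D U|.

Definition arc_connected_flip (k : nat) D J : Prop :=
  J \subset arcs D /\ arc_connected k (reverse D J).

Definition dicut D B : Prop :=
  exists U, [/\ U != set0, U \proper [set: V], din D U = set0 & B = dout D U].

Definition dijoin (m : nat) D J : Prop :=
  J \subset arcs D /\ forall B, dicut D B -> m <= #|J :&: B|.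

Lemma card_din_reverse D J U :
  #|din (reverse D J) U| =
  #|dout D U :&: J| + #|din D U| - #|din D U :&: J|.
Proof.
rewrite -addnBA ?subset_leq_card ?subsetIl // -cardsD -cardsUI.
rewrite (_ : _ :&: (_ :\: _) = set0) ?cards0 ?addn0.
  apply: eq_card => a; rewrite !inE /=.
  by case: (a \in J); case: (a \in arcs D); case: (_ \in U); case: (_ \in U).
apply/setP=> a; rewrite !inE.
by case: (a \in J); case: (a \in arcs D); case: (_ \in U); case: (_ \in U).
Qed.

Lemma arc_connected_flipE k D J :
  arc_connected_flip k D J <->
  J \subset arcs D /\
  forall U, U != set0 -> U \proper [set: V] ->
    k <= #|dout D U :&: J| + #|din D U| - #|din D U :&: J|.
Proof.
by split=> -[sJ cJ]; split=> // U U0 UT; have := cJ U U0 UT;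
  rewrite card_din_reverse.
Qed.

End Digraphs.

Local Open Scope ring_scope.

Definition weight (R : realFieldType) (E : finType) (w : E -> R)
  (B : {set E}) : R := \sum_(a in B) w a.

(* Main.v *)
Require Import Defs.
From mathcomp Require Import all_boot all_order all_algebra.
From mathcomp Require Import zify ring lra.
Import Order.TTheory GRing.Theory Num.Theory.
Local Open Scope ring_scope.

Set Implicit Arguments.
Unset Strict Implicit.
Unset Printing Implicit Defensive.

(** Let A1 be the set of arcs of weight 1, write d+ and d- for the numbers of
arcs of A1 leaving and entering a vertex set, and for J included in A1 let z be
the vector on the vertices counting, at each vertex, the arcs of J out of it
minus the arcs of J into it.  Both requirements depend on J through z only.
Reversing J gives a k-arc-connected digraph iff z(U) <= d+(U) - k for all
nonempty proper U (this is the cut condition at the complement of U), and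
A1 \ J is a (tau - k)-dijoin iff z(U) <= d+(U) - (tau - k) for all U whose
outgoing arcs form a dicut.  Conversely a vector z with z(V) = 0 comes from some
J as soon as z(U) <= d+(U) for all U ([exists_net]), and the first system of
inequalities implies this.  So it is enough to find an integer vector z with
z(V) = 0 satisfying both systems.

By the hypothesis on w, the fractional vector z(U) = (k / tau) (d+(U) - d-(U))
satisfies both: use it at the complement of U for the first system, and at U
for the second. Each right-hand side is d+ minus a constant, a submodular
function, over a crossing family, and the intersection of two base polyhedra
of crossing submodular functions is integral
([integral_crossing_intersection]). To round a point b of the intersection,
consider for each system the sets whose inequality is tight at b, and the
partition of V into atoms, two vertices being in the same atom when no tight
set separates them. By uncrossing, the sum of b over each atom is an integer
([int_sum_atom]), so an atom containing a fractional entry of b contains at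
least two. Counting then gives a nonzero vector d supported on the fractional
entries with sum 0 over each atom of both partitions ([common_direction]).
Moving along d keeps every tight inequality tight, and moving until a further
one becomes tight makes progress. *)

(** * Sums over vertex sets *)

Section SetSums.
Variables (V : finType) (K : zmodType).
Implicit Types (b : V -> K) (U W : {set V}).

Lemma sum_setC b U :
  \sum_(v in ~: U) b v = \sum_v b v - \sum_(v in U) b v.
Proof.
rewrite [\sum_v _](bigID (mem U)) /= addrC addrK.
by apply: eq_bigl => v; rewrite inE.
Qed.

Lemma sum_setUI b U W :
  \sum_(v in U :|: W) b v + \sum_(v in U :&: W) b v =
  \sum_(v in U) b v + \sum_(v in W) b v.
Proof.
rewrite [\sum_(v in U) _]big_mkcond [\sum_(v in W) _]big_mkcond.
rewrite [\sum_(v in U :|: W) _]big_mkcond [\sum_(v in U :&: W) _]big_mkcond.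
rewrite -!big_split /=; apply: eq_bigr => v _; rewrite !inE.
by case: (v \in U); case: (v \in W); rewrite /= ?addr0 ?add0r.
Qed.

End SetSums.

Lemma setC_eq0 (V : finType) (U : {set V}) : (~: U == set0) = (U == setT).
Proof. by rewrite -setCT (inj_eq (@setC_inj _)). Qed.

Lemma setC_eqT (V : finType) (U : {set V}) : (~: U == setT) = (U == set0).
Proof. by rewrite -setC0 (inj_eq (@setC_inj _)). Qed.

(** * A direction with zero sum over the classes of two partitions *)

Lemma card_classes_le (V T : finType) (c : V -> T) (F : {set V}) :
    (forall v, v \in F -> exists u, [/\ u \in F, u != v & c u = c v]) ->
  (#|c @: F|.*2 <= #|F|)%N.
Proof.
move=> partner; rewrite -[#|F|]sum1_card (partition_big_imset c) /=.
rewrite -muln2 -sum_nat_const; apply: leq_sum => _ /imsetP[v vF ->].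
have [u [uF uv cu]] := partner v vF.
rewrite (bigD1 v) /= ?vF ?eqxx // (bigD1 u) /= ?uF ?cu ?eqxx ?uv //; lia.
Qed.

(** The unknowns are the values of [d] on [F], and there is one equation for each
class meeting [F].  Every class meeting [F] does so at least twice, so there are
at most [#|F|] equations; they are linearly dependent, since the equations of
either partition add up to the same one, the total sum.  So a nonzero solution
exists. *)
Lemma common_direction (K : fieldType) (V T : finType) (c : bool -> V -> T)
    (F : {set V}) :
    F != set0 ->
    (forall t v, v \in F -> exists u, [/\ u \in F, u != v & c t u = c t v]) ->
  exists d : V -> K, [/\ forall v, v \notin F -> d v = 0, exists v, d v != 0
    & forall t a, \sum_(v | c t v == a) d v = 0].
Proof.
move=> F0 partner.
pose n t := #|c t @: F|; pose m := #|F|.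
have n_le t : ((n t).*2 <= m)%N by apply: card_classes_le; exact: partner.
have m_gt0 : (0 < m)%N by rewrite card_gt0.
(* The system d *m row_mx (M true) (M false) = 0 is the required one. *)
pose M t : 'M[K]_(m, n t) :=
  \matrix_(i, j) (c t (enum_val i) == enum_val j)%:R.
(* The dependency: the columns of each block add up to the all-one vector. *)
have M1 t : M t *m const_mx 1 = const_mx 1 :> 'cV_m.
  apply/colP=> i; rewrite !mxE.
  have ci : c t (enum_val i) \in c t @: F by rewrite imset_f ?enum_valP.
  rewrite (bigD1 (enum_rank_in ci (c t (enum_val i)))) //= !mxE.
  rewrite enum_rankK_in // eqxx mulr1 big1 ?addr0 // => j ji.
  rewrite !mxE; case: eqP => [cj|_]; last by rewrite mul0r.
  by case/eqP: ji; apply: enum_val_inj; rewrite enum_rankK_in.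
have [free|] := boolP (row_free (row_mx (M true) (M false))).
  pose z : 'cV[K]_(n true + n false) := col_mx (const_mx 1) (- const_mx 1).
  have Mz : row_mx (M true) (M false) *m z = 0.
    by rewrite mul_row_col mulmxN !M1 subrr.
  have full : row_full (row_mx (M true) (M false)).
    rewrite /row_full eqn_leq rank_leq_col (eqP free) /=.
    by have := n_le true; have := n_le false; lia.
  have z0 : z = 0.
    by apply: (row_full_inj full); rewrite Mz mulmx0.
  have nt : (0 < n true)%N.
    have [v vF] := set0Pn _ F0.
    by rewrite card_gt0; apply/set0Pn; exists (c true v); rewrite imset_f.
  have /matrixP/(_ (lshift _ (Ordinal nt)) 0) := z0.
  by rewrite col_mxEu !mxE => /eqP; rewrite oner_eq0.
rewrite -kermx_eq0 => /rowV0Pn[x /sub_kermxP xM x0].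
move: xM; rewrite mul_mx_row => /eqP; rewrite row_mx_eq0 => /andP[xMt xMf].
have xM t : x *m M t = 0 by apply/eqP; case: t.
have [v0 v0F] := set0Pn _ F0.
pose d v := if v \in F then x 0 (enum_rank_in v0F v) else 0.
have dE i : d (enum_val i) = x 0 i by rewrite /d enum_valP enum_valK_in.
exists d; split=> [v /negPf|| t a]; first by rewrite /d => ->.
  case/rV0Pn: x0 => i xi; exists (enum_val i); rewrite dE; exact: xi.
rewrite (bigID (mem F)) /= [X in _ + X]big1 => [|v /andP[_ /negPf]]; last first.
  by rewrite /d => ->.
rewrite addr0 (eq_bigl (fun v => (v \in F) && (c t v == a))); last first.
  by move=> v; rewrite andbC.
have [aF|aF] := boolP (a \in c t @: F); last first.
  rewrite big1 // => v /andP[vF /eqP cv]; case/negP: aF.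
  by rewrite -cv imset_f.
move/rowP/(_ (enum_rank_in aF a)): (xM t); rewrite !mxE => xMa.
rewrite -[RHS]xMa big_mkcondr /= big_enum_val /=; apply: eq_bigr => i _.
rewrite dE !mxE enum_rankK_in //.
by case: eqP => _; rewrite ?mulr1 ?mulr0.
Qed.

(** * Atoms of a crossing family *)

Section Atoms.
Variable V : finType.
Implicit Types (T N : {set {set V}}) (U W X Z : {set V}) (b : V -> rat).

(** The maximal members of a family closed under union of intersecting sets are
pairwise disjoint and cover the same elements. *)
Lemma int_sum_cover N b :
    {in N &, forall U W, U :&: W != set0 -> U :|: W \in N} ->
    {in N, forall U, \sum_(v in U) b v \is a Num.int} ->
  \sum_(v in cover N) b v \is a Num.int.
Proof.
move=> Nint Nb; pose M := [set U | maxset (mem N) U].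
have MN U : U \in M -> U \in N by rewrite inE => /maxsetp.
have trivM : trivIset M.
  apply/trivIsetP => U W UM WM; apply: contraNT; rewrite -setI_eq0 => UW.
  have UWN := Nint _ _ (MN _ UM) (MN _ WM) UW.
  move: UM WM; rewrite !inE => /maxsetP[_ maxU] /maxsetP[_ maxW].
  by rewrite -(maxU _ UWN (subsetUl _ _)) {1}(maxW _ UWN (subsetUr _ _)).
have -> : cover N = cover M.
  apply/setP=> v; apply/bigcupP/bigcupP => -[U UN vU].
    have [W maxW UW] := maxset_exists (P := mem N) UN.
    by exists W; [rewrite inE | apply: (subsetP UW)].
  by exists U; rewrite ?MN.
by rewrite big_trivIset //; apply: rpred_sum => U UM; rewrite Nb ?MN.
Qed.

Lemma int_sum_coverI N Z b :
    {in N &, forall U W, U :&: W != set0 -> U :|: W \in N} ->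
    {in N, forall U, \sum_(v in U :&: Z) b v \is a Num.int} ->
  \sum_(v in cover N :&: Z) b v \is a Num.int.
Proof.
move=> Nint Nb.
have restrict X : \sum_(v in X :&: Z) b v =
    \sum_(v in X) (if v \in Z then b v else 0).
  by rewrite -big_mkcondr /=; apply: eq_bigl => v; rewrite inE.
by rewrite restrict; apply: int_sum_cover => // U UN; rewrite -restrict Nb.
Qed.

(** Stated for comparable pairs as well, since these satisfy it trivially. *)
Definition crossing_family T :=
  {in T &, forall U W, U :&: W != set0 -> U :|: W != setT ->
    U :&: W \in T /\ U :|: W \in T}.

Definition atom T v := [set u | [forall U in T, (u \in U) == (v \in U)]].

Lemma mem_atom T u v : (u \in atom T v) = (atom T u == atom T v).
Proof.
apply/idP/eqP => [|<-]; last by rewrite inE; apply/forall_inP.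
rewrite inE => /forall_inP uv; apply/setP => x; rewrite !inE.
by apply: eq_forallb_in => U UT; rewrite (eqP (uv U UT)).
Qed.

(** The complement of the atom of [v] is the union of the members of [T] avoiding
[v] (family [N1]) and of the complements of the members containing [v] (family
[N2]).  Seen from [v], the crossing condition makes [N1] and [N2] closed under
union of intersecting members, so both unions have integer sums; and so has the
intersection of the two unions, because [b] has an integer sum over [U :&: X]
for [U] in [N1] and [X] in [N2]: either these sets are comparable, or [U]
crosses the complement of [X] and [U :\: X] is in [T]. *)
Lemma int_sum_atom T b v :
    crossing_family T -> \sum_u b u \is a Num.int ->
    {in T, forall U, \sum_(u in U) b u \is a Num.int} ->
  \sum_(u in atom T v) b u \is a Num.int.
Proof.
move=> crossT bV bT.
pose N1 := [set U in T | v \notin U].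
pose N2 := [set X | (~: X \in T) && (v \notin X)].
have N1U : {in N1 &, forall U W, U :&: W != set0 -> U :|: W \in N1}.
  move=> U W; rewrite !inE => /andP[UT vU] /andP[WT vW] UW.
  have [] // := crossT U W UT WT UW.
    by apply/eqP=> /setP/(_ v); rewrite !inE (negPf vU) (negPf vW).
  by move=> _ ->; rewrite negb_or vU.
have N2U : {in N2 &, forall X Y, X :&: Y != set0 -> X :|: Y \in N2}.
  move=> X Y; rewrite !inE => /andP[XT vX] /andP[YT vY] XY.
  have [] // := crossT _ _ XT YT.
  - by apply/set0Pn; exists v; rewrite !inE vX.
  - by rewrite -setCI setC_eqT.
  by rewrite -setCU => -> _; rewrite negb_or vX.
have bN1 : {in N1, forall U, \sum_(u in U) b u \is a Num.int}.
  by move=> U; rewrite inE => /andP[/bT].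
have bN2 : {in N2, forall X, \sum_(u in X) b u \is a Num.int}.
  move=> X; rewrite inE => /andP[/bT bX _].
  by rewrite -[X]setCK sum_setC rpredB.
have bN12 : \sum_(u in cover N1 :&: cover N2) b u \is a Num.int.
  apply: int_sum_coverI => // U UN1; rewrite setIC; apply: int_sum_coverI => //.
  move=> X XN2; have := UN1; have := XN2.
  rewrite !inE => /andP[XT vX] /andP[UT vU].
  have [UX|UX] := boolP (U \subset X); first by rewrite (setIidPr UX) bN1.
  have [XU|XU] := boolP (X \subset U); first by rewrite (setIidPl XU) bN2.
  have [] // := crossT U _ UT XT.
  - by rewrite -setDE setD_eq0.
  - apply: contra XU => /eqP UXT; apply/subsetP => u uX.
    by have := in_setT u; rewrite -UXT !inE uX orbF.
  move=> UDX _; have := bT U UT; rewrite (big_setID X) /= setDE setIC.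
  by rewrite rpredDr // bT.
have -> : atom T v = ~: (cover N1 :|: cover N2).
  apply/setP=> u; rewrite !inE -[LHS]negbK; congr negb.
  rewrite negb_forall_in; apply/exists_inP/orP => [[U UT]|].
    have [vU|vU] := boolP (v \in U); last first.
      rewrite eqbF_neg negbK => uU; left; apply/bigcupP; exists U => //.
      by rewrite inE UT.
    rewrite eqb_id => uU; right; apply/bigcupP; exists (~: U).
      by rewrite !inE setCK UT vU.
    by rewrite inE.
  case=> /bigcupP[X]; rewrite inE => /andP[XT vX] uX.
    by exists X => //; move: uX; rewrite (negPf vX) => ->.
  by exists (~: X) => //; move: uX; rewrite !inE (negPf vX) => ->.
rewrite sum_setC rpredB //.
have /eqP := sum_setUI b (cover N1) (cover N2).
rewrite eq_sym -subr_eq => /eqP <-.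
by rewrite rpredB ?rpredD ?int_sum_cover.
Qed.

(** A member of [T] is a union of atoms. *)
Lemma sum_atom0 T (K : zmodType) (d : V -> K) U :
    (forall a, \sum_(v | atom T v == a) d v = 0) -> U \in T ->
  \sum_(v in U) d v = 0.
Proof.
move=> d0 UT; rewrite (partition_big (atom T) predT) //= big1 // => a _.
have [v /andP[vU /eqP va]|none] := pickP [pred v in U | atom T v == a];
  last first.
  by rewrite big_pred0 // => v; have := none v.
rewrite -[RHS](d0 a); apply: eq_bigl => u; apply: andb_idl => ua.
move: ua; rewrite -va -mem_atom inE => /forall_inP/(_ U UT)/eqP ->; exact: vU.
Qed.

End Atoms.

(** * Intersection of two crossing submodular systems *)

(** Moving along a direction with rates [g], the slacks [s] of a feasible point
stay nonnegative until the first of them, among those that decrease, vanishes;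
ratio test of the simplex method. *)
Lemma step_to_boundary (K : realFieldType) (I : finType) (s g : I -> K) :
    (forall i, 0 <= s i) -> (forall i, s i = 0 -> g i = 0) ->
    (exists i, 0 < g i) ->
  exists t, (forall i, 0 <= s i - t * g i) /\
    exists i, s i != 0 /\ s i - t * g i = 0.
Proof.
move=> s_ge0 sg [i0 gi0].
have [i gi imin] :=
  @arg_minP _ K I i0 (fun i => 0 < g i) (fun i => s i / g i) gi0.
have si : s i != 0 by apply/eqP=> /sg gi_0; move: gi; rewrite gi_0 ltxx.
exists (s i / g i); split=> [j|]; last first.
  by exists i; rewrite divfK ?subrr // gt_eqF.
have t_ge0 : 0 <= s i / g i by rewrite divr_ge0 // ltW.
case: (ltrP 0 (g j)) => gj.
  by rewrite subr_ge0 -ler_pdivlMr //; exact: imin.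
by have := s_ge0 j; have := mulr_ge0_le0 t_ge0 gj; lra.
Qed.

Section CrossingIntersection.
Variable V : finType.
Implicit Types (U W : {set V}).

Definition crossing_submodular (C : {set {set V}}) (f : {set V} -> int) :=
  crossing_family C /\
  {in C &, forall U W, U :&: W != set0 -> U :|: W != setT ->
    f (U :&: W) + f (U :|: W) <= f U + f W}.

(** The two systems are indexed by a boolean.  The proof is by induction on the
number of constraints that are not tight at [b]; the upper bounds [c] ensure
that a move along a nonzero vector of sum 0 reaches a constraint. *)
Theorem integral_crossing_intersection (C : bool -> {set {set V}})
    (f : bool -> {set V} -> int) (c : V -> int) (b : V -> rat) :
    (forall t, crossing_submodular (C t) (f t)) ->
    (forall t, {in C t, forall U, \sum_(v in U) b v <= (f t U)%:~R}) ->
    (forall v, b v <= (c v)%:~R) -> \sum_v b v = 0 ->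
  exists z : V -> int,
    [/\ forall t, {in C t, forall U, \sum_(v in U) z v <= f t U},
        forall v, z v <= c v & \sum_v z v = 0].
Proof.
move=> Cf bf bc bV.
(* Sets outside the families get the constant slack 1, never tight. *)
pose slack x (i : bool * {set V} + V) : rat :=
  match i with
  | inl (t, U) => if U \in C t then (f t U)%:~R - \sum_(v in U) x v else 1
  | inr v => (c v)%:~R - x v
  end.
have: forall i, 0 <= slack b i.
  case=> [[t U]|v] /=; rewrite ?subr_ge0 //.
  by case: ifP => // /bf; rewrite subr_ge0.
move: bV {bf bc}; have [m] := ubnP #|[set i | slack b i != 0]|.
elim: m b => // m IHm b lem bV b_ge0.
have [/forallP bint|] := boolP [forall v, b v \is a Num.int].
  have bE v : b v = (Num.floor (b v))%:~R.
    by apply/esym/eqP; rewrite -intrEfloor.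
  exists (fun v => Num.floor (b v)); split=> [t U UC|v|].
  - have := b_ge0 (inl (t, U)); rewrite /= UC subr_ge0.
    rewrite -(ler_int rat) rmorph_sum.
    by congr (_ <= _); apply: eq_bigr => v _; exact: bE.
  - by rewrite -(ler_int rat) -bE -subr_ge0; exact: (b_ge0 (inr v)).
  - by apply/eqP; rewrite -(eqr_int rat) mulr0z -bV rmorph_sum;
    apply/eqP/eq_bigr => v _; exact/esym/bE.
rewrite negb_forall => /existsP[v0 bv0].
pose T t := [set U in C t | slack b (inl (t, U)) == 0].
have TE t U : U \in T t -> U \in C t /\ \sum_(v in U) b v = (f t U)%:~R.
  by rewrite inE /= => /andP[UC]; rewrite UC subr_eq0 eq_sym => /eqP.
(* Uncrossing: tight sets intersect and unite into tight sets. *)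
have crossT t : crossing_family (T t).
  move=> U W /TE[UC bU] /TE[WC bW] UW0 UWT.
  have [/(_ _ _ UC WC UW0 UWT)[IC XC] /(_ _ _ UC WC UW0 UWT) sub] := Cf t.
  have := b_ge0 (inl (t, U :&: W)); have := b_ge0 (inl (t, U :|: W)).
  rewrite !inE /= IC XC !subr_eq0 !subr_ge0 /=.
  move: sub; rewrite -(ler_int rat) !rmorphD /= -bU -bW.
  have := sum_setUI b U W; lra.
have bT t : {in T t, forall U, \sum_(v in U) b v \is a Num.int}.
  by move=> U /TE[_ ->]; rewrite intr_int.
pose F := [set v | b v \isn't a Num.int].
have F0 : F != set0 by apply/set0Pn; exists v0; rewrite inE.
(* The sum over an atom is an integer, so it has no single fractional entry. *)
have [t v|d [dF [v1 dv1] d0]] :=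
    common_direction (c := fun t => atom (T t)) rat F0.
  rewrite inE => bv; have := int_sum_atom v (crossT t) _ (bT t).
  rewrite bV rpred0 => /(_ isT).
  have vv : v \in atom (T t) v by rewrite mem_atom.
  rewrite (big_setD1 v) //= => sum_int.
  have [u /andP[uv bu]|none] :=
      pickP [pred u in atom (T t) v :\ v | b u \isn't a Num.int].
    exists u; move: uv; rewrite in_setD1 mem_atom => /andP[uv /eqP ua].
    by rewrite inE.
  case/negP: bv.
  rewrite -(rpredDr (b v) (x := \sum_(u in atom (T t) v :\ v) b u)) //.
  by apply: rpred_sum => u uv; have := none u; rewrite /= uv /= => /negbFE.
have dV : \sum_v d v = 0.
  by rewrite (partition_big (atom (T true)) predT) //= big1.
pose g (i : bool * {set V} + V) : rat :=
  match i with
  | inl (t, U) => if U \in C t then \sum_(v in U) d v else 0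
  | inr v => d v
  end.
have g0 i : slack b i = 0 -> g i = 0.
  case: i => [[t U] sU|v sv] /=.
    case: ifP => // UC; apply: sum_atom0 (d0 t) _.
    by rewrite inE UC sU eqxx.
  apply: dF; rewrite inE negbK; move/eqP: sv; rewrite /= subr_eq0 => /eqP <-.
  exact: intr_int.
have [|t [st_ge0 [i [si sti]]]] := step_to_boundary b_ge0 g0.
  suff [v dv] : exists v, 0 < d v by exists (inr v).
  apply/existsP; apply: contraT; rewrite negb_exists => /forallP d_le0.
  have := psumr_eq0P (P := predT) (F := fun v => - d v).
  rewrite sumrN dV oppr0 => /(_ _ erefl v1 isT) => H.
  case/eqP: dv1; apply/eqP; rewrite -oppr_eq0 H // => v _.
  by rewrite oppr_ge0 leNgt.
have slackE j : slack (fun v => b v + t * d v) j = slack b j - t * g j.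
  case: j => [[s U]|v] /=; last by ring.
  case: ifP => _; last by ring.
  by rewrite big_split -mulr_sumr /=; ring.
apply: (IHm (fun v => b v + t * d v)) => [||j]; last by rewrite slackE.
  rewrite -ltnS (leq_trans _ lem) // ltnS; apply: proper_card; apply/properP.
  split; last by exists i; rewrite !inE ?slackE ?sti ?eqxx.
  apply/subsetP => j; rewrite !inE slackE; apply: contraNN => /eqP sj.
  by rewrite sj g0 // mulr0 subr0.
by rewrite big_split -mulr_sumr /= bV dV mulr0 addr0.
Qed.
End CrossingIntersection.

(** * Outdegrees and net outdegree vectors *)

Section Degrees.
Variables (V E : finType) (D : digraph V E).
Implicit Types (B J : {set E}) (U W : {set V}) (z : V -> int).

Definition leaves a U := (src D a \in U) && (tgt D a \notin U).

Definition outdeg B U : int := \sum_(a in B) (leaves a U)%:R.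

Definition arc_net (a : E) (v : V) : int :=
  (src D a == v)%:R - (tgt D a == v)%:R.

Definition net B v : int := \sum_(a in B) arc_net a v.

Lemma outdegE B U : outdeg B U = #|dout (subdigraph D B) U|%:R.
Proof.
rewrite -sum1_card natr_sum /outdeg [LHS]big_mkcond [RHS]big_mkcond.
by apply: eq_bigr => a _; rewrite inE /leaves /=; do !case: (_ \in _).
Qed.

Lemma din_dout G U : din (G : digraph V E) U = dout G (~: U).
Proof. by apply/setP=> a; rewrite !inE negbK. Qed.

Lemma dout_subdigraph G J U : J \subset arcs G ->
  dout (subdigraph (G : digraph V E) J) U = dout G U :&: J.
Proof.
move=> /subsetP JG; apply/setP=> a; rewrite !inE andbC.
by have [/JG ->|] := boolP (a \in J); rewrite ?andbT ?andbF.
Qed.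

Lemma din_setIU0 U W : din D U = set0 -> din D W = set0 ->
  din D (U :&: W) = set0 /\ din D (U :|: W) = set0.
Proof.
move=> /setP dU /setP dW; split; apply/setP=> a; move: (dU a) (dW a).
  by rewrite !inE; do !case: (_ \in _).
by rewrite !inE; do !case: (_ \in _).
Qed.

Lemma outdeg_ge0 B U : 0 <= outdeg B U.
Proof. by rewrite outdegE. Qed.

Lemma outdegD1 B a U : a \in B ->
  outdeg B U = (leaves a U)%:R + outdeg (B :\ a) U.
Proof. exact: big_setD1. Qed.

Lemma outdegID B J U : J \subset B ->
  outdeg B U = outdeg J U + outdeg (B :\: J) U.
Proof. by move=> /setIidPr JB; rewrite /outdeg (big_setID J) JB. Qed.

Lemma outdeg_submod B U W :
  outdeg B (U :&: W) + outdeg B (U :|: W) <= outdeg B U + outdeg B W.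
Proof.
rewrite -!big_split; apply: ler_sum => a _; rewrite /leaves !inE.
by do !case: (_ \in _).
Qed.

Lemma sum_arc_net a U :
  \sum_(v in U) arc_net a v = (leaves a U)%:R - (leaves a (~: U))%:R.
Proof.
have sum1 x : \sum_(v in U) (x == v)%:R = (x \in U)%:R :> int.
  rewrite big_mkcond (bigD1 x) //= eqxx big1 ?addr0 => [|v /negPf vx].
    by case: (x \in U).
  by rewrite eq_sym vx if_same.
rewrite sumrB !sum1 /leaves !inE negbK.
by case: (src D a \in U); case: (tgt D a \in U).
Qed.

Lemma sum_net B U : \sum_(v in U) net B v = outdeg B U - outdeg B (~: U).
Proof.
rewrite exchange_big -sumrB; apply: eq_bigr => a _; exact: sum_arc_net.
Qed.

(** A special case of Hoffman's circulation theorem, by induction on [B].  An arc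
[a] can be left out of [J] unless some [U] left by [a] is tight, and put in [J]
unless some [W] entered by [a] is tight.  If both fail, uncrossing [U] and [W]
contradicts the submodularity of the outdegree, as [a] leaves neither [U :&: W]
nor [U :|: W]. *)
Lemma exists_net z B :
    (forall U, \sum_(v in U) z v <= outdeg B U) -> \sum_v z v = 0 ->
  exists J : {set E}, J \subset B /\ forall v, z v = net J v.
Proof.
have [n] := ubnP #|B|; elim: n B z => // n IHn B z Bn zB z0.
have [B0|/set0Pn[a aB]] := eqVneq B set0.
  exists set0; split=> [|v]; first exact: sub0set.
  have z_le0 U : \sum_(v in U) z v <= 0.
    by rewrite (le_trans (zB U)) // B0 /outdeg big_set0.
  have := z_le0 (~: [set v]); have := z_le0 [set v].
  rewrite sum_setC z0 !big_set1 /net big_set0; lia.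
have Ban : (#|B :\ a| < n)%N by move: Bn; rewrite (cardsD1 a) aB.
have [/forallP out_ok|] :=
    boolP [forall U : {set V}, \sum_(v in U) z v <= outdeg (B :\ a) U].
  have [J [JB zJ]] := IHn _ z Ban out_ok z0.
  by exists J; split=> //; rewrite (subset_trans JB) ?subD1set.
rewrite negb_forall => /existsP[U]; rewrite -ltNge -lezD1 => zU.
pose z' v := z v - arc_net a v.
have z'E W : \sum_(v in W) z' v =
    \sum_(v in W) z v - ((leaves a W)%:R - (leaves a (~: W))%:R).
  by rewrite sumrB sum_arc_net.
have [W||J [JB zJ]] := IHn (B :\ a) z' Ban.
- rewrite z'E; apply: contraT; rewrite -ltNge -lezD1 => zW.
  have zUI := sum_setUI z U W; have sub := outdeg_submod (B :\ a) U W.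
  have := zB U; have := zB W; have := zB (U :&: W); have := zB (U :|: W).
  move: zW; rewrite !(outdegD1 _ aB) /leaves !inE.
  by do !case: (_ \in _) => /=; lra.
- rewrite -(eq_bigl _ _ (@in_setT V)) z'E (eq_bigl _ _ (@in_setT V)) z0.
  by rewrite /leaves !inE !subr0.
- exists (a |: J); split=> [|v].
    by rewrite subUset sub1set aB (subset_trans JB) ?subD1set.
  have aJ : a \notin J by apply/negP=> /(subsetP JB); rewrite setD11.
  by rewrite /net big_setU1 //= -/(net J v) -zJ addrC subrK.
Qed.
End Degrees.

(** * Flips and dijoins *)

Theorem theorem18 (R : realFieldType) (tau k : nat)
    (k_ge1 : (1 <= k)%N) (k_le : (k <= tau - 1)%N)
    (V E : finType) (D : digraph V E) (w : E -> R)
    (w01 : forall a, a \in arcs D -> w a = 0 \/ w a = 1)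
    (w_cut : forall U : {set V}, U != set0 -> U \proper [set: V] ->
       weight w (dout D U) + (tau%:R / k%:R - 1) * weight w (din D U)
         >= tau%:R) :
  let A1 := [set a in arcs D | w a == 1] in
  exists J K : {set E},
    [/\ J :|: K = A1, [disjoint J & K],
        arc_connected_flip k (subdigraph D A1) J
      & dijoin (tau - k) D K].
Proof.
move=> A1; pose out := outdeg D A1.
have weightE U : weight w (dout D U) = (out U)%:~R.
  rewrite /out outdegE mulrz_nat -sum1_card natr_sum /weight.
  rewrite [LHS]big_mkcond [RHS]big_mkcond; apply: eq_bigr => a _.
  rewrite !inE /=; have [aD|//] := boolP (a \in arcs D).
  by case: (w01 a aD) => ->; rewrite ?eqxx ?(eq_sym 0) ?oner_eq0 /= ?if_same.
(* The hypothesis multiplied by [k], which makes it an inequality in integers. *)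
have cut (U : {set V}) : U != set0 -> U != setT ->
    tau%:Z * k%:Z <= k%:Z * out U + (tau%:Z - k%:Z) * out (~: U).
  move=> U0 UT; rewrite -properT in UT; have := w_cut U U0 UT.
  rewrite din_dout !weightE -(ler_int R) => cutU.
  have k_gt0 : 0 < k%:R :> R by rewrite ltr0n.
  rewrite !(rmorphM, rmorphD, rmorphN) /= -!pmulrn.
  rewrite -(ler_pM2l k_gt0) in cutU; rewrite mulrC (le_trans cutU) //.
  by rewrite mulrDr mulrA mulrBr mulrCA divff ?gt_eqF // !mulr1.
have out0 : out set0 = 0.
  by rewrite /out /outdeg big1 // => a _; rewrite /leaves !inE.
have outT : out setT = 0.
  by rewrite /out /outdeg big1 // => a _; rewrite /leaves !inE.
(* [true] is the system of the dijoin, [false] that of the flip. *)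
pose C (t : bool) :=
  [set U : {set V} | [&& U != set0, U != setT & t ==> (din D U == set0)]].
pose f (t : bool) (U : {set V}) := out U - (if t then tau%:Z - k%:Z else k%:Z).
pose b v : rat := k%:R / tau%:R * (net D A1 v)%:~R.
have bE (U : {set V}) :
    \sum_(v in U) b v = k%:R / tau%:R * (out U - out (~: U))%:~R.
  by rewrite -mulr_sumr -sum_net rmorph_sum.
have b_le x y : k%:Z * x <= tau%:Z * y -> k%:R / tau%:R * x%:~R <= y%:~R :> rat.
  have tau_gt0 : 0 < tau%:R :> rat by rewrite ltr0n; lia.
  rewrite mulrAC ler_pdivrMr // -(ler_int rat) !rmorphM /= -!pmulrn.
  by rewrite [y%:~R * _]mulrC.
have A1D : A1 \subset arcs D by apply/subsetP => a; rewrite inE => /andP[].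
have outC0 U : din D U = set0 -> out (~: U) = 0.
  rewrite /out outdegE dout_subdigraph // -din_dout => ->.
  by rewrite set0I cards0.
have out_ge0 U : 0 <= out U := outdeg_ge0 D A1 U.
have [|t U| v||z [zC _ z0]] :=
    @integral_crossing_intersection V C f (fun v => out [set v]) b.
- move=> t; split=> U W; rewrite !inE;
    move=> /and3P[U0 UT dU] /and3P[W0 WT dW] UW0 UWT.
    rewrite UW0 UWT /=.
    have -> : U :&: W != setT.
      by apply: contra UT; rewrite -!subTset subsetI => /andP[].
    have -> : U :|: W != set0 by rewrite setU_eq0 negb_and U0.
    case: t dU dW => //= /eqP dU /eqP dW.
    by have [-> ->] := din_setIU0 dU dW.
  rewrite /f; have := outdeg_submod D A1 U W; rewrite -/out; lia.
- rewrite inE => /and3P[U0 UT dU]; rewrite bE; apply: b_le.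
  have CU0 : ~: U != set0 by rewrite setC_eq0.
  have CUT : ~: U != setT by rewrite setC_eqT.
  have := cut U U0 UT; have := cut _ CU0 CUT; rewrite setCK /f.
  have := out_ge0 U; have := out_ge0 (~: U).
  case: t dU => /= [/eqP /outC0|_]; nia.
- have := bE [set v]; rewrite big_set1 => ->; apply: b_le.
  have := out_ge0 [set v]; have := out_ge0 (~: [set v]); nia.
- by rewrite -(eq_bigl _ _ (@in_setT V)) bE setCT out0 outT subrr mulr0.
have [U|J [JA zJ]] := exists_net (D := D) (B := A1) (z := z) _ z0.
  have [->|U0] := eqVneq U set0; first by rewrite big_set0 outdeg_ge0.
  have [->|UT] := eqVneq U setT.
    by rewrite (eq_bigl _ _ (@in_setT V)) z0 outdeg_ge0.
  have := zC false U; rewrite inE U0 UT => /(_ isT) /=; rewrite /f /out; lia.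
have netJ (U : {set V}) : \sum_(v in U) z v = outdeg D J U - outdeg D J (~: U).
  by rewrite -sum_net; apply: eq_bigr.
exists J, (A1 :\: J); split.
- by rewrite -{1}(setIidPr JA) setID.
- by rewrite -setI_eq0 setIDA setDIl setDv set0I.
- apply/arc_connected_flipE; split=> // U U0; rewrite properT => UT.
  have CU0 : ~: U != set0 by rewrite setC_eq0.
  have CUT : ~: U != setT by rewrite setC_eqT.
  have := zC false (~: U); rewrite inE CU0 CUT => /(_ isT).
  have doutJ W : dout (subdigraph D A1) W :&: J = dout (subdigraph D J) W.
    by rewrite -dout_subdigraph.
  rewrite din_dout !doutJ netJ setCK /f /out !outdegE /=; lia.
- have KD : A1 :\: J \subset arcs D := subset_trans (subsetDl _ _) A1D.
  split=> // B [U [U0]]; rewrite properT => UT dU ->.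
  rewrite setIC -dout_subdigraph //.
  have := zC true U; rewrite inE U0 UT dU eqxx => /(_ isT).
  have := outC0 U dU; have := outdeg_ge0 D J (~: U).
  have := outdeg_ge0 D (A1 :\: J) (~: U).
  rewrite netJ /f /out !(outdegID _ _ JA) (outdegE _ (A1 :\: J) U); lia.
Qed.
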